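(* Consider the $2$-user linear deterministic Z interference channel with parameters $(m,n)$, with unidirectional transmitter cooperation of rate $C$ from transmitter $2$ to transmitter $1$ and with the secrecy constraint at receiver $1$. Let $\alpha=n/m$ and suppose $\alpha\ge 2$ (very high interference regime). Then every rate pair $(R_1,R_2)$ in the secrecy capacity region satisfies $$R_1\le m,\qquad R_2\le 0.$$
   Context: Linear deterministic Z interference channel: let $m\ge 1$, $n\ge 0$ be integers and $q=\max\{m,n\}$. In each channel use, transmitter $1$ sends a binary vector $\mathbf{x}_1$ of length $m$ and transmitter $2$ sends a binary vector $\mathbf{x}_2$ of length $q$ (a vector shorter than $q$ is regarded as occupying the top entries of a length-$q$ vector, the remaining entries being $0$). The outputs are $$\mathbf{y}_1=\mathbf{D}^{q-m}\mathbf{x}_1\oplus\mathbf{D}^{q-n}\mathbf{x}_2,\qquad \mathbf{y}_2=\mathbf{D}^{q-m}\mathbf{x}_2,$$ where $\oplus$ is entrywise addition modulo $2$ and $\mathbf{D}$ is the $q\times q$ downshift matrix with entries $d_{j',j''}=1$ if $2\le j'=j''+1\le q$ and $0$ otherwise. Thus receiver $2$ observes the top $m$ bits of $\mathbf{x}_2$, and receiver $1$ observes the modulo-$2$ sum of the top $m$ bits of $\mathbf{x}_1$ and the top $n$ bits of $\mathbf{x}_2$, aligned at the bottom. The channel is used $N$ times without memory; $\mathbf{x}_i^N,\mathbf{y}_i^N$ denote the blocks of $N$ inputs and outputs. Messages and encoding: $W_1,W_2$ are independent and uniformly distributed, $W_i$ on a set of size $2^{NR_i}$. A noiseless and secure cooperative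 link of rate $C\ge 0$ bits per channel use (an integer) goes from transmitter $2$ to transmitter $1$; the signal sent on it during the block is $\mathbf{v}_{21}^N$, with $H(\mathbf{v}_{21}^N)\le NC$. The signals $\mathbf{x}_2^N$ and $\mathbf{v}_{21}^N$ are functions of $W_2$ and possibly local randomness at transmitter $2$, so they are independent of $W_1$. The input of transmitter $1$ is a function of $W_1$, of the cooperative signal received so far (causality: it may not depend on cooperative signals sent in the future), and possibly of local randomness (artificial noise). The local randomness at the two transmitters is independent of each other and of the messages. In particular, $(W_1,\mathbf{x}_1^N)\to\mathbf{v}_{21}^N\to(W_2,\mathbf{x}_2^N)$ is a Markov chain. Secrecy capacity region: $(R_1,R_2)$ is achievable if there is a sequence of such codes with $N\to\infty$ for which receiver $i$ decodes $W_i$ from $\mathbf{y}_i^N$ with error probability tending to $0$ ($i=1,2$) and weak secrecy holds: $\frac1N I(W_2;\mathbf{y}_1^N)\to 0$. (Secrecy of $W_1$ at receiver $2$ is automatic, since transmitter $1$ is not connected to receiver $2$.) The secrecy capacity region is the closure of the set of achievable pairs. Entropies and mutual informations are in bits. *)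

(* Defs.v *)
From HB Require Import structures.
From mathcomp Require Import all_boot all_order all_algebra.
From mathcomp Require Import all_classical all_reals all_analysis.

Set Implicit Arguments.
Unset Strict Implicit.
Unset Printing Implicit Defensive.

Import Order.TTheory GRing.Theory Num.Theory.
Import numFieldNormedType.Exports.

Local Open Scope classical_set_scope.
Local Open Scope ring_scope.

Section Information.
Context {R : realType} {d : measure_display} {Omega : measurableType d}.
Variable P : probability Omega R.

Definition log2 (x : R) : R := ln x / ln 2.

Definition finite_rv (A : finType) (X : Omega -> A) : Prop :=
  forall a, measurable (X @^-1` [set a]).

Definition fin_pmf (A : finType) (X : Omega -> A) (a : A) : R :=
  fine (P (X @^-1` [set a])).

(* [ln 0 = 0] and [_ / 0 = 0], so both sums below follow the convention
   0 log 0 = 0. *)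
Definition entropy (A : finType) (X : Omega -> A) : R :=
  - \sum_(a : A) fin_pmf X a * log2 (fin_pmf X a).

Definition mutual_info (A B : finType) (X : Omega -> A) (Y : Omega -> B) : R :=
  \sum_(a : A) \sum_(b : B)
    let pab := fin_pmf (fun w => (X w, Y w)) (a, b) in
    pab * log2 (pab / (fin_pmf X a * fin_pmf Y b)).

Definition uniform_rv (A : finType) (X : Omega -> A) : Prop :=
  forall a, P (X @^-1` [set a]) = (#|A|%:R^-1 : R)%:E.

(* Two finite and two general random variables.  The product rule for
   subfamilies is the case where some of the [B]s are the full space, summed
   over the values of the omitted finite variables. *)
Definition mutually_independent4 (A1 A2 : finType) (d1 d2 : measure_display)
    (T1 : measurableType d1) (T2 : measurableType d2)
    (X1 : Omega -> A1) (X2 : Omega -> A2)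
    (S1 : Omega -> T1) (S2 : Omega -> T2) : Prop :=
  forall a1 a2 (B1 : set T1) (B2 : set T2), measurable B1 -> measurable B2 ->
    P (X1 @^-1` [set a1] `&` X2 @^-1` [set a2] `&` S1 @^-1` B1 `&` S2 @^-1` B2)
    = (P (X1 @^-1` [set a1]) * P (X2 @^-1` [set a2])
       * P (S1 @^-1` B1) * P (S2 @^-1` B2))%E.

End Information.

Section Channel.
Variables m n : nat.

Definition qlen : nat := maxn m n.

Definition downshift : 'M['F_2]_qlen :=
  \matrix_(i, j) ((nat_of_ord i == j.+1)%N)%:R.

(* [x] occupies the top entries; the entries below it are 0. *)
Definition pad (x : 'cV['F_2]_m) : 'cV['F_2]_qlen :=
  \col_i oapp (fun j : 'I_m => x j 0) 0 (insub (nat_of_ord i)).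

Definition output1 (x1 : 'cV['F_2]_m) (x2 : 'cV['F_2]_qlen) : 'cV['F_2]_qlen :=
  downshift ^+ (qlen - m) *m pad x1 + downshift ^+ (qlen - n) *m x2.

Definition output2 (x2 : 'cV['F_2]_qlen) : 'cV['F_2]_qlen :=
  downshift ^+ (qlen - m) *m x2.

End Channel.

(* [M1] and [M2] are the numbers of messages.  The local randomness [rand1],
   [rand2] takes values in arbitrary measurable spaces.  The cooperative signal
   of one channel use lives in an arbitrary finite alphabet; only the entropy of
   the whole block is limited by the link rate. *)
Record zic_code (R : realType) (m n C N M1 M2 : nat) := ZicCode {
  outcome_display : measure_display; outcome : measurableType outcome_display;
  prob : probability outcome R;
  seed1_display : measure_display; seed1 : measurableType seed1_display;
  seed2_display : measure_display; seed2 : measurableType seed2_display;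
  link_alphabet : finType;
  msg1 : outcome -> 'I_M1;
  msg2 : outcome -> 'I_M2;
  rand1 : outcome -> seed1;
  rand2 : outcome -> seed2;
  enc1 : 'I_N -> 'I_M1 -> {ffun 'I_N -> link_alphabet} -> seed1 -> 'cV['F_2]_m;
  enc2 : 'I_M2 -> seed2 -> {ffun 'I_N -> 'cV['F_2]_(qlen m n)};
  coop : 'I_M2 -> seed2 -> {ffun 'I_N -> link_alphabet};
  dec1 : {ffun 'I_N -> 'cV['F_2]_(qlen m n)} -> 'I_M1;
  dec2 : {ffun 'I_N -> 'cV['F_2]_(qlen m n)} -> 'I_M2;
  msg1_rv : finite_rv msg1;
  msg2_rv : finite_rv msg2;
  rand1_rv : measurable_fun setT rand1;
  rand2_rv : measurable_fun setT rand2;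
  msg1_uniform : uniform_rv prob msg1;
  msg2_uniform : uniform_rv prob msg2;
  msg_rand_independent : mutually_independent4 prob msg1 msg2 rand1 rand2;
  enc1_rv : forall t w v, finite_rv (enc1 t w v);
  enc2_rv : forall w, finite_rv (enc2 w);
  coop_rv : forall w, finite_rv (coop w);
  enc1_causal : forall (t : 'I_N) w (v v' : {ffun 'I_N -> link_alphabet}) s,
    (forall i : 'I_N, (i <= t)%N -> v i = v' i) -> enc1 t w v s = enc1 t w v' s;
  coop_rate :
    entropy prob (fun w => coop (msg2 w) (rand2 w)) <= N%:R * C%:R
}.

Section CodeSignals.
Variables (R : realType) (m n C N M1 M2 : nat) (c : zic_code R m n C N M1 M2).

Definition coop_signal (w : outcome c) : {ffun 'I_N -> link_alphabet c} :=
  coop (msg2 w) (rand2 w).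

Definition input1 (w : outcome c) : {ffun 'I_N -> 'cV['F_2]_m} :=
  [ffun t => enc1 t (msg1 w) (coop_signal w) (rand1 w)].

Definition input2 (w : outcome c) : {ffun 'I_N -> 'cV['F_2]_(qlen m n)} :=
  enc2 (msg2 w) (rand2 w).

Definition received1 (w : outcome c) : {ffun 'I_N -> 'cV['F_2]_(qlen m n)} :=
  [ffun t => output1 (input1 w t) (input2 w t)].

Definition received2 (w : outcome c) : {ffun 'I_N -> 'cV['F_2]_(qlen m n)} :=
  [ffun t => output2 (input2 w t)].

Definition error1 : R := fine (prob c [set w | dec1 c (received1 w) <> msg1 w]).

Definition error2 : R := fine (prob c [set w | dec2 c (received2 w) <> msg2 w]).

Definition leakage : R := mutual_info (prob c) (@msg2 _ _ _ _ _ _ _ c) received1.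

End CodeSignals.

(* 2^(N rho), rounded up to an integer for general real [rho]. *)
Definition message_count (R : realType) (N : nat) (rho : R) : nat :=
  `|Num.ceil (2 `^ (N%:R * rho))|%N.

Definition achievable (R : realType) (m n C : nat) (r : R * R) : Prop :=
  [/\ 0 <= r.1, 0 <= r.2 &
   exists (N : nat -> nat)
     (c : forall k, zic_code R m n C (N k)
            (message_count (N k) r.1) (message_count (N k) r.2)),
   [/\ N k @[k --> \oo] --> \oo,
       error1 (c k) @[k --> \oo] --> (0 : R),
       error2 (c k) @[k --> \oo] --> (0 : R) &
       (N k)%:R^-1 * leakage (c k) @[k --> \oo] --> (0 : R)]].

Definition secrecy_capacity_region (R : realType) (m n C : nat) : set (R * R) :=
  closure [set r : R * R | achievable m n C r].

(* Main.v *)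
(* If [n >= 2 m], the top [m] bits of [x2] arrive at receiver 1 above the signal
   of transmitter 1, so [y2] is a function of [y1]: receiver 1 can decode [W2],
   and a Fano-type inequality turns this into a leakage of about [N R2], which
   secrecy forces to be [o(N)].  For [R1], fix everything but [W1]: transmitter 1
   then has at most [2^(N m)] distinct inputs, so at most that many of the
   [2^(N R1)] messages can be decoded correctly. *)
Require Import Defs.
From mathcomp Require Import all_boot all_order all_algebra.
From mathcomp Require Import all_classical all_reals all_analysis.
From mathcomp Require Import ring lra zify.
Import Order.TTheory GRing.Theory Num.Theory.
Import numFieldNormedType.Exports.

Local Open Scope classical_set_scope.
Local Open Scope ring_scope.

(** * Probability mass functions of finite random variables *)

Section FiniteRandomVariables.
Context {R : realType} {d : measure_display} {Omega : measurableType d}.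
Context (P : probability Omega R).

Lemma preimage_bigcup1 {A : Type} (X : Omega -> A) (S : set A) :
  X @^-1` S = \bigcup_(a in S) (X @^-1` [set a]).
Proof.
apply/seteqP; split => w /=; first by exists (X w).
by case=> a Sa /= ->.
Qed.

Lemma finite_rv_preimage {A : finType} {X : Omega -> A} (S : set A) :
  finite_rv X -> measurable (X @^-1` S).
Proof.
move=> mX; rewrite preimage_bigcup1.
by apply: fin_bigcup_measurable => // a _; apply: mX.
Qed.

Lemma finite_rv_comp {A B : finType} {X : Omega -> A} (f : A -> B) :
  finite_rv X -> finite_rv (fun w => f (X w)).
Proof.
by move=> mX b; apply: (finite_rv_preimage (fun a => f a = b) mX).
Qed.

Lemma preimage_pair1 {A B : Type} (X : Omega -> A) (Y : Omega -> B) a b :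
  (fun w => (X w, Y w)) @^-1` [set (a, b)] = X @^-1` [set a] `&` Y @^-1` [set b].
Proof. by apply/seteqP; split => w /= [-> ->]. Qed.

Lemma finite_rv_pair {A B : finType} {X : Omega -> A} {Y : Omega -> B} :
  finite_rv X -> finite_rv Y -> finite_rv (fun w => (X w, Y w)).
Proof.
by move=> mX mY [a b]; rewrite preimage_pair1; apply: measurableI.
Qed.

Lemma fin_pmf_ge0 {A : finType} (X : Omega -> A) a : 0 <= fin_pmf P X a.
Proof. exact: fine_ge0. Qed.

Lemma probability_preimage {A : finType} {X : Omega -> A} (S : pred A) :
  finite_rv X ->
  fine (P (X @^-1` [set` S])) = \sum_(a | S a) fin_pmf P X a.
Proof.
move=> mX; rewrite preimage_bigcup1 measure_fin_bigcup //; last first.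
  by move=> a b _ _ [w [/= <- <-]].
rewrite -(bigfs _ (index_enum_uniq A)); last by move=> a _; rewrite mem_index_enum.
by rewrite sum_fine// => a _; rewrite fin_num_measure.
Qed.

Lemma fin_pmf_comp {A B : finType} {X : Omega -> A} (f : A -> B) b :
  finite_rv X ->
  fin_pmf P (fun w => f (X w)) b = \sum_(a | f a == b) fin_pmf P X a.
Proof.
move=> /probability_preimage <-; congr (fine (P _)).
by apply/seteqP; split => w /= /eqP.
Qed.

Lemma sum_fin_pmf {A : finType} {X : Omega -> A} :
  finite_rv X -> \sum_a fin_pmf P X a = 1.
Proof.
move=> /probability_preimage <-.
by rewrite set_true preimage_setT probability_setT.
Qed.

Lemma probability_preimageC {A : finType} {X : Omega -> A} (S : pred A) :
  finite_rv X ->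
  1 - fine (P (X @^-1` [set` S])) = \sum_(a | ~~ S a) fin_pmf P X a.
Proof.
move=> mX; rewrite (probability_preimage _ mX) -(sum_fin_pmf mX).
by rewrite (bigID S) /= addrAC subrr add0r.
Qed.

Lemma fin_pmf_marginal {A B : finType} {X : Omega -> A} {Y : Omega -> B} b :
  finite_rv (fun w => (X w, Y w)) ->
  fin_pmf P Y b = \sum_a fin_pmf P (fun w => (X w, Y w)) (a, b).
Proof.
move=> mXY; rewrite (fin_pmf_comp snd b mXY).
transitivity (\sum_a \sum_(b' | b' == b) fin_pmf P (fun w => (X w, Y w)) (a, b')).
  by rewrite pair_big_dep; apply: eq_big => -[].
by apply: eq_bigr => a _; rewrite big_pred1_eq.
Qed.

Lemma uniform_rv_pmf {A : finType} {X : Omega -> A} a :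
  uniform_rv P X -> fin_pmf P X a = #|A|%:R^-1.
Proof. by rewrite /fin_pmf => ->. Qed.

(** * Two converse bounds: a Fano-type inequality and a counting bound *)

(* [ln x <= x - 1] applied to the inverse of [p / (q r)] *)
Lemma mul_log2_ge (p q r : R) : 0 <= p -> 0 <= q -> (q = 0 -> p = 0) -> 0 < r ->
  p * ln r + p - q * r <= p * log2 (p / q) * ln 2.
Proof.
move=> p0 q0 qp r0; have l2 : ln 2 != 0 :> R by rewrite gt_eqF// ln_gt0// ltr1n.
have -> : p * log2 (p / q) * ln 2 = p * ln (p / q).
  by rewrite /log2 -mulrA divfK.
have [->|p_neq0] := eqVneq p 0; first by rewrite !mul0r add0r sub0r oppr_le0 mulr_ge0// ltW.
have pp : 0 < p by rewrite lt0r p_neq0.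
have qq : 0 < q by rewrite lt0r q0 andbT; apply: contra_neq p_neq0.
(* With this [x], [p * ln (p / q) = p * ln r - p * ln x] and [p * (1 - x) = p - q * r]. *)
pose x := q * r / p; have x0 : 0 < x by rewrite divr_gt0// mulr_gt0.
have -> : ln (p / q) = ln r - ln x.
  by rewrite -ln_div ?posrE//; congr ln; rewrite /x; field; rewrite ?gt_eqF.
have -> : q * r = p * x by rewrite /x; field.
have := @le_ln1Dx R (x - 1); rewrite subrKC => lnx.
have /(ler_wpM2l p0) : ln x <= x - 1 by apply: lnx; lra.
rewrite !mulrBr mulr1; lra.
Qed.

(* Apply [mul_log2_ge] with [r = #|A|] where the decoder is right and [r = 1]
   elsewhere: under the product law a fixed decoder is right with probability
   [1 / #|A|], so the weight has mean at most 2. *)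
Lemma mutual_info_decoder {A B : finType} {X : Omega -> A} {Y : Omega -> B}
    (h : B -> A) :
  finite_rv (fun w => (X w, Y w)) -> uniform_rv P X -> (0 < #|A|)%N ->
  (1 - fine (P [set w | h (Y w) <> X w])) * ln #|A|%:R - 1
    <= mutual_info P X Y * ln 2.
Proof.
move=> mXY uX A0; set M := #|A|%:R : R.
have M0 : 0 < M by rewrite ltr0n.
set p := fin_pmf P (fun w => (X w, Y w)); set q := fin_pmf P Y.
have q0 b : 0 <= q b by exact: fin_pmf_ge0.
have p0 a b : 0 <= p (a, b) by exact: fin_pmf_ge0.
have mY : finite_rv Y := finite_rv_comp snd mXY.
have qE b : q b = \sum_a p (a, b) := fin_pmf_marginal b mXY.
have sp : \sum_a \sum_b p (a, b) = 1.
  by rewrite exchange_big -[RHS](sum_fin_pmf mY) /=; apply: eq_bigr => b _.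
pose r a b : R := if h b == a then M else 1.
have pE : \sum_a \sum_b p (a, b) * ln (r a b) =
    (1 - fine (P [set w | h (Y w) <> X w])) * ln M.
  have -> : [set w | h (Y w) <> X w] =
      (fun w => (X w, Y w)) @^-1` [set` [pred ab | h ab.2 != ab.1]].
    by apply/seteqP; split => w /= /eqP.
  rewrite (probability_preimageC _ mXY) mulr_suml.
  rewrite pair_big /= [RHS]big_mkcond; apply: eq_bigr => -[a b] _ /=.
  by rewrite /r negbK; case: eqP; rewrite ?ln1 ?mulr0.
have qrE : \sum_a \sum_b (M^-1 * q b) * r a b <= 2.
  have sq : \sum_b q b = 1 := sum_fin_pmf mY.
  have -> : 2 = \sum_b (q b + q b) by rewrite big_split/= sq.
  rewrite exchange_big; apply: ler_sum => b _ /=.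
  (* The guess [h b] contributes [q b]; the other values, fewer than [#|A|], contribute [q b / M]
     each. *)
  rewrite (bigD1 (h b))//= /r eqxx mulrAC mulVf ?gt_eqF// mul1r lerD2l.
  rewrite (eq_bigr (fun=> M^-1 * q b)); last first.
    by move=> a; rewrite eq_sym => /negbTE ->; rewrite mulr1.
  rewrite sumr_const -mulr_natl mulrA ler_piMl//.
  by rewrite ler_pdivrMr// mul1r ler_nat max_card.
have le_sum : \sum_a \sum_b (p (a, b) * ln (r a b) + p (a, b) - M^-1 * q b * r a b)
    <= mutual_info P X Y * ln 2.
  rewrite /mutual_info mulr_suml; apply: ler_sum => a _.
  rewrite mulr_suml; apply: ler_sum => b _ /=.
  rewrite (uniform_rv_pmf a uX) -/p -/q -/M; apply: mul_log2_ge => //.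
  - by rewrite mulr_ge0// invr_ge0 ltW.
  (* Absolute continuity: [q b] sums the nonnegative [p (a, b)], so it vanishes only if all of them
     do. *)
  - move=> /eqP; rewrite mulf_eq0 invr_eq0 gt_eqF//= qE psumr_eq0//.
    by move=> /allP/(_ a); rewrite mem_index_enum => /(_ isT)/eqP.
  - by rewrite /r; case: eqP.
apply: le_trans le_sum.
under eq_bigr do rewrite big_split big_split sumrN /=.
(* The constant [-1] is the total mass 1 of [p] minus the bound 2 of [qrE]. *)
rewrite big_split big_split sumrN /= sp pE; lra.
Qed.

(* For a fixed [z], at most [#|V|] of the values of [X] are decoded correctly. *)
Lemma decoding_count {A T V : finType} {X : Omega -> A} {Z : Omega -> T}
    (enc : A -> T -> V) (dec : V -> T -> A) :
  finite_rv (fun w => (X w, Z w)) -> uniform_rv P X ->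
  (forall a z, fin_pmf P (fun w => (X w, Z w)) (a, z)
    = fin_pmf P X a * fin_pmf P Z z) ->
  (1 - fine (P [set w | dec (enc (X w) (Z w)) (Z w) <> X w])) * #|A|%:R
    <= #|V|%:R.
Proof.
move=> mXZ uX indep; pose ok a z := dec (enc a z) z == a.
have mZ : finite_rv Z := finite_rv_comp snd mXZ.
have -> : [set w | dec (enc (X w) (Z w)) (Z w) <> X w] =
    (fun w => (X w, Z w)) @^-1` [set` [pred az | ~~ ok az.1 az.2]].
  by apply/seteqP; split => w /= /eqP.
rewrite (probability_preimageC _ mXZ).
have -> : \sum_(az | ~~ [pred az | ~~ ok az.1 az.2] az)
      fin_pmf P (fun w => (X w, Z w)) az
    = \sum_z \sum_(a | ok a z) #|A|%:R^-1 * fin_pmf P Z z.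
  rewrite (exchange_big_dep xpredT)//= pair_big_dep /=.
  apply: eq_big => -[a z] /=; first by rewrite negbK.
  by rewrite indep (uniform_rv_pmf a uX).
rewrite mulr_suml.
have -> : #|V|%:R = \sum_z #|V|%:R * fin_pmf P Z z :> R.
  by rewrite -mulr_sumr (sum_fin_pmf mZ) mulr1.
apply: ler_sum => z _; rewrite sumr_const.
have [A0|A_gt0] := posnP #|A|; first by rewrite A0 mulr0 mulr_ge0 ?ler0n ?fin_pmf_ge0.
have A0 : #|A|%:R != 0 :> R by rewrite pnatr_eq0 -lt0n.
rewrite -[X in X * _ <= _]mulr_natl -mulrA mulrAC mulVf// mul1r.
rewrite ler_wpM2r ?fin_pmf_ge0// ler_nat.
(* On the correctly decoded messages [dec] is a left inverse of [enc] at [z], so [enc^~ z] is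
   injective there. *)
rewrite -(card_in_imset (f := enc^~ z)) ?max_card// => x y.
by rewrite !unfold_in /ok => /eqP {2}<- /eqP {2}<- ->.
Qed.
End FiniteRandomVariables.

Lemma finite_rv_ffun {d : measure_display} {Omega : measurableType d}
    {I A : finType} {X : I -> Omega -> A} :
  (forall i, finite_rv (X i)) -> finite_rv (fun w => [ffun i => X i w]).
Proof.
move=> mX f.
have -> : (fun w => [ffun i => X i w]) @^-1` [set f]
    = \bigcap_(i in [set: I]) (X i @^-1` [set f i]).
  apply/seteqP; split => w /=.
    by move=> + i _ /= => <-; rewrite ffunE.
  by move=> fw; apply/ffunP => i; rewrite ffunE; exact: fw.
by apply: fin_bigcap_measurable => // i _; apply: mX.
Qed.

(** * Shift algebra of the channel *)

Lemma downshift_nilpotent (m n k : nat) : (qlen m n <= k)%N ->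
  downshift m n ^+ k = 0.
Proof.
move=> qk; apply/matrixP => i j; rewrite mxE.
(* Induction on [k] shows that row [i] of the [k]-th power vanishes once [i < k]: one more factor
   turns row [i - 1] into row [i], and row 0 into zero. *)
have: (i < k)%N := leq_trans (ltn_ord i) qk.
move: i j; elim: k {qk} => [//|k IH] i j ik.
rewrite exprS mxE big1// => l _; rewrite mxE.
by case: eqP => [il|]; rewrite ?mul0r// IH ?mulr0//; lia.
Qed.

(* For [n >= 2 * m] the top [m] bits of [x2] reach receiver 1 without
   interference. *)
Lemma output2_degraded (m n : nat) (x1 : 'cV['F_2]_m) (x2 : 'cV['F_2]_(qlen m n)) :
  (2 * m <= n)%N ->
  output2 x2 = downshift m n ^+ (qlen m n - m) *m output1 x1 x2.
Proof.
move=> mn; have qE : qlen m n = n by rewrite /qlen; lia.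
rewrite /output1 [(qlen m n - n)%N](_ : _ = 0%N); last by lia.
(* [x2] arrives unshifted because [qlen m n = n]; [x1] is shifted by [2 (n - m) >= n] in total and
   disappears. *)
rewrite expr0 mul1mx mulmxDr mulmxA mulmxE -exprD.
by rewrite downshift_nilpotent ?mul0mx ?add0r//; lia.
Qed.

Lemma finite_rv_measurable_comp {d d' : measure_display}
    {Omega : measurableType d} {T : measurableType d'} {A : finType}
    (f : T -> A) (g : Omega -> T) :
  finite_rv f -> measurable_fun setT g -> finite_rv (fun w => f (g w)).
Proof.
by move=> mf mg a; rewrite -[X in measurable X]setTI; apply: mg (mf a).
Qed.

(** * Bounds for a single code *)

Section Converse.
Context {R : realType} {m n C N M1 M2 : nat} (c : zic_code R m n C N M1 M2).

Let block := {ffun 'I_N -> 'cV['F_2]_(qlen m n)}.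
Let link := {ffun 'I_N -> link_alphabet c}.

Let table := {ffun 'I_N * 'I_M1 * link -> 'cV['F_2]_m}.
Let env := ('I_M2 * (block * link) * table)%type.

Definition enc1_table (s : seed1 c) : table :=
  [ffun p => enc1 p.1.1 p.1.2 p.2 s].

(* Everything random in the channel besides [msg1].  The seeds range over
   arbitrary spaces, but only finitely many encoder behaviours exist. *)
Definition environment (w : outcome c) : env :=
  (msg2 w, (input2 w, coop_signal w), enc1_table (rand1 w)).

(** Once [w2] is fixed, [input2] and the link signal depend on [rand2] alone. This product form is
    what the independence of messages and seeds applies to. *)
Lemma environment_rectangle w2 e t :
  environment @^-1` [set (w2, e, t)] =
    msg2 (z := c) @^-1` [set w2] `&` rand1 (z := c) @^-1` (enc1_table @^-1` [set t])
    `&` rand2 (z := c) @^-1` ((fun s => (enc2 w2 s, coop w2 s)) @^-1` [set e]).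
Proof.
apply/seteqP; split => w; rewrite /environment /input2 /coop_signal /=.
  by case=> -> <- <-.
by move=> [[-> ->]] <-.
Qed.

Lemma enc1_table_rv : finite_rv enc1_table.
Proof. by apply: finite_rv_ffun => p; apply: enc1_rv. Qed.

Lemma enc2_coop_rv w2 : finite_rv (fun s : seed2 c => (enc2 w2 s, coop w2 s)).
Proof. by apply: finite_rv_pair; [apply: enc2_rv | apply: coop_rv]. Qed.

Lemma environment_rv : finite_rv environment.
Proof.
move=> [[w2 e] t]; rewrite environment_rectangle.
apply: measurableI; first apply: measurableI.
- exact: msg2_rv.
- exact: (finite_rv_measurable_comp _ _ enc1_table_rv (rand1_rv (z := c))).
- exact: (finite_rv_measurable_comp _ _ (enc2_coop_rv w2) (rand2_rv (z := c))).
Qed.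

Lemma msg1_environment_rv : finite_rv (fun w => (msg1 w, environment w)).
Proof. by apply: finite_rv_pair; [apply: msg1_rv | apply: environment_rv]. Qed.

(** The joint mass is that of [a] times a factor [k] free of [a]; summing over [a] identifies [k] as
    the mass of [z]. *)
Lemma msg1_environment_independent a z :
  fin_pmf (prob c) (fun w => (msg1 w, environment w)) (a, z)
  = fin_pmf (prob c) (@msg1 _ _ _ _ _ _ _ c) a * fin_pmf (prob c) environment z.
Proof.
case: z => [[w2 e] t]; pose B1 := enc1_table @^-1` [set t].
pose B2 := (fun s : seed2 c => (enc2 w2 s, coop w2 s)) @^-1` [set e].
pose k := fine (prob c (msg2 (z := c) @^-1` [set w2])
  * prob c (rand1 (z := c) @^-1` B1) * prob c (rand2 (z := c) @^-1` B2)).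
have mB1 : measurable (rand1 (z := c) @^-1` B1) :=
  finite_rv_measurable_comp _ _ enc1_table_rv (rand1_rv (z := c)) t.
have mB2 : measurable (rand2 (z := c) @^-1` B2) :=
  finite_rv_measurable_comp _ _ (enc2_coop_rv w2) (rand2_rv (z := c)) e.
have joint a' : fin_pmf (prob c) (fun w => (msg1 w, environment w)) (a', (w2, e, t))
    = fin_pmf (prob c) (@msg1 _ _ _ _ _ _ _ c) a' * k.
  rewrite /fin_pmf /k -fineM ?fin_numM ?fin_num_measure//;
    [|exact: msg1_rv|exact: msg2_rv].
  rewrite !muleA -msg_rand_independent; [|exact: enc1_table_rv|exact: enc2_coop_rv].
  congr (fine (prob c _)); rewrite -setIA -setIA setIA.
  rewrite preimage_pair1.
  by rewrite environment_rectangle -!setIA.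
rewrite joint (fin_pmf_marginal _ _ msg1_environment_rv).
under eq_bigr do rewrite joint.
by rewrite -mulr_suml (sum_fin_pmf _ (msg1_rv c)) mul1r.
Qed.

Definition codeword a (z : env) : {ffun 'I_N -> 'cV['F_2]_m} :=
  [ffun t => z.2 (t, a, z.1.2.2)].

Definition superpose (v : {ffun 'I_N -> 'cV['F_2]_m}) (z : env) : block :=
  [ffun t => output1 (v t) (z.1.2.1 t)].

Lemma received1E w :
  received1 w = superpose (codeword (msg1 w) (environment w)) (environment w).
Proof. by apply/ffunP => t; rewrite !ffunE. Qed.

(** Receiver 1 is granted the whole environment. Given it, [msg1] acts only through [codeword], so
    the exponent is [N * m] and not the length [N * qlen m n] of the received block. *)
Lemma decoding1_bound : (1 - error1 c) * M1%:R <= (2 ^ (N * m))%:R.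
Proof.
have := decoding_count _ codeword (fun v z => dec1 c (superpose v z))
  msg1_environment_rv (msg1_uniform c) msg1_environment_independent.
rewrite card_ffun card_mx card_Fp// !card_ord muln1 -expnM mulnC /error1.
rewrite [X in prob c X](_ : _ = [set w | dec1 c (received1 w) <> msg1 w])//.
by apply/seteqP; split => w /=; rewrite received1E.
Qed.

Lemma decoding2_bound : (2 * m <= n)%N -> (0 < M2)%N ->
  (1 - error2 c) * ln M2%:R - 1 <= leakage c * ln 2.
Proof.
(* Receiver 1 imitates receiver 2: it shifts each received vector and applies [dec2], hence errs
   exactly when receiver 2 does. *)
move=> mn M2_gt0; pose h (y : block) :=
  dec2 c [ffun t => downshift m n ^+ (qlen m n - m) *m y t].
have rv : finite_rv (fun w : outcome c => (msg2 w, received1 w)).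
  pose f (az : 'I_M1 * env) := (az.2.1.1, superpose (codeword az.1 az.2) az.2).
  rewrite (_ : (fun w => _) = (fun w => f (msg1 w, environment w))).
    exact: finite_rv_comp f msg1_environment_rv.
  by apply/funext => w; rewrite received1E.
have := mutual_info_decoder _ h rv (msg2_uniform c).
rewrite card_ord => /(_ M2_gt0); rewrite /error2.
rewrite [X in prob c X](_ : _ = [set w | dec2 c (received2 w) <> msg2 w])//.
have h_received w : h (received1 w) = dec2 c (received2 w).
  congr (dec2 c _); apply/ffunP => t; rewrite ffunE [received1 w t]ffunE [RHS]ffunE.
  by rewrite (output2_degraded _ _ (input1 w t)).
by apply/seteqP; split => w /=; rewrite h_received.
Qed.

End Converse.

(** * Passage to the limit along a sequence of codes *)

(** Linear growth of the excess message count in [N] already contradicts a vanishing error. *)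
Lemma powR2_ge1D {R : realType} (x : R) : 1 + x * ln 2 <= 2 `^ x.
Proof. by rewrite /powR pnatr_eq0 expR_ge1Dx. Qed.

Lemma message_count_ge {R : realType} N (r : R) :
  2 `^ (N%:R * r) <= (message_count N r)%:R.
Proof.
rewrite /message_count natr_absz ger0_norm ?ceil_ge//.
by rewrite ceil_ge0// (lt_le_trans _ (powR_ge0 _ _))// ltrN10.
Qed.

Lemma message_count_gt0 {R : realType} N (r : R) : (0 < message_count N r)%N.
Proof.
by rewrite -(ltr0n R) (lt_le_trans _ (message_count_ge N r))// powR_gt0// ltr0n.
Qed.

Lemma achievable_bounds {R : realType} {m n C : nat} {r : R * R} :
  (2 * m <= n)%N -> achievable m n C r -> r.1 <= m%:R /\ r.2 <= 0.
Proof.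
move=> mn [_ _ [N [c [N_oo e1_0 e2_0 leak_0]]]].
have N_gt0 : \forall k \near \oo, (0 < N k)%N by exact: (N_oo _ (nbhs_infty_gt 0)).
have NV_0 : (N k)%:R^-1 @[k --> \oo] --> (0 : R).
  apply/gtr0_cvgV0; first by apply: filterS N_gt0 => k; rewrite ltr0n.
  exact: cvg_comp N_oo cvgr_idn.
have l2 : 0 < ln 2 :> R by rewrite ln_gt0// ltr1n.
split.
  rewrite leNgt; apply/negP => r1_gt; set x := r.1 - m%:R.
  have x_gt0 : 0 < x by rewrite subr_gt0.
  suff : (1 : R) <= 0 by rewrite ler10.
  (* A rate excess [x > 0] forces this null sequence to be eventually at least 1. *)
  have lim0 : error1 (c k) + (N k)%:R^-1 * (x * ln 2)^-1 @[k --> \oo] --> (0 : R).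
    rewrite -[X in _ --> X]addr0; apply: cvgD => //.
    by rewrite -[X in _ --> X](mul0r (x * ln 2)^-1); apply: cvgMr_tmp.
  apply: (cvgr_to_ge lim0); apply: filterS N_gt0 => k Nk_gt0.
  set e := error1 (c k); have Nk0 : 0 < (N k)%:R :> R by rewrite ltr0n.
  have [e1|e1] := leP 1 e.
    by rewrite (le_trans e1)// lerDl mulr_ge0// invr_ge0 ltW// mulr_gt0.
  have := decoding1_bound (c k); rewrite -/e => count.
  have {}count := le_trans (ler_wpM2l (ltW _) (message_count_ge (N k) r.1)) count.
  have pow_gt0 : 0 < 2 `^ ((N k)%:R * m%:R) :> R by rewrite powR_gt0// ltr0n.
  (* The count divided by [2 ^ (N m)]; then [2 ^ (N x)] is bounded below by [1 + N x ln 2]. *)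
  have : (1 - e) * 2 `^ ((N k)%:R * x) <= 1.
    rewrite -(ler_pM2r pow_gt0) mul1r -mulrA -powRD ?pnatr_eq0 ?implybT//.
    rewrite -mulrDr subrK -[in leRHS]natrM powR_mulrn// -natrX.
    by apply: count; rewrite subr_gt0.
  move=> /(le_trans (ler_wpM2l (ltW _) (powR2_ge1D _))); rewrite subr_gt0.
  move=> /(_ e1); rewrite -invfM -lerBlDl => bound.
  rewrite -[leRHS]mul1r ler_pdivlMr ?mulr_gt0//.
  by apply: le_trans bound; rewrite ler_wpM2l ?subr_ge0 ?ltW// mulrA ltrDr.
(* Dividing [decoding2_bound] by [N ln 2] bounds [r.2] by this null sequence. *)
have lim0 : (N k)%:R^-1 * leakage (c k) + error2 (c k) * r.2
     + (N k)%:R^-1 * (ln 2)^-1 @[k --> \oo] --> (0 : R).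
  rewrite -[X in _ --> X]addr0; apply: cvgD.
    rewrite -[X in _ --> X]addr0; apply: cvgD => //.
    by rewrite -[X in _ --> X](mul0r r.2); apply: cvgMr_tmp.
  by rewrite -[X in _ --> X](mul0r (ln 2)^-1); apply: cvgMr_tmp.
apply: (cvgr_to_ge lim0).
(* Makes [1 - e] nonnegative, so that the lower bound on [ln] of the message count can be multiplied
   by it. *)
have e2_lt1 : \forall k \near \oo, error2 (c k) < 1 by apply: (cvgr_lt _ e2_0); exact: ltr01.
near=> k; have Nk_gt0 : (0 < N k)%N by near: k.
have e_lt1 : error2 (c k) < 1 by near: k.
have Nk0 : 0 < (N k)%:R :> R by rewrite ltr0n.
have := decoding2_bound (c k) mn (message_count_gt0 _ _).
set e := error2 _ in e_lt1 *; set L := leakage _ => bound.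
have lnM : (N k)%:R * r.2 * ln 2 <= ln (message_count (N k) r.2)%:R :> R.
  by rewrite -ln_powR ler_ln ?posrE ?powR_gt0 ?ltr0n ?message_count_gt0 ?message_count_ge.
have e_ge0 : 0 <= 1 - e by rewrite subr_ge0 ltW.
have {}lnM := ler_wpM2l e_ge0 lnM.
rewrite -(ler_pM2r (mulr_gt0 Nk0 l2)).
have -> : ((N k)%:R^-1 * L + e * r.2 + (N k)%:R^-1 / ln 2) * ((N k)%:R * ln 2)
    = L * ln 2 + e * ((N k)%:R * r.2 * ln 2) + 1.
  by field; rewrite !gt_eqF.
lra.
Unshelve. all: by end_near. Qed.

Theorem theorem3 (R : realType) (m n C : nat) (hm : (1 <= m)%N)
    (halpha : 2 <= n%:R / m%:R :> R) (R1 R2 : R)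
    (hR : secrecy_capacity_region m n C (R1, R2)) :
  R1 <= m%:R /\ R2 <= 0.
Proof.
have mn : (2 * m <= n)%N.
  by move: halpha; rewrite ler_pdivlMr ?ltr0n// -natrM ler_nat.
(* The bounds cut out a closed set, so they pass from achievable pairs to the closure. *)
pose B : set (R * R) := fst @^-1` [set x | x <= m%:R] `&` snd @^-1` [set x | x <= 0].
have /closure_id clB : closed B.
  apply: closedI.
    by apply: preimage_closed; [move=> r _; exact: cvg_fst | exact: closed_le].
  by apply: preimage_closed; [move=> r _; exact: cvg_snd | exact: closed_le].
have : closure B (R1, R2) by apply: closureS hR => r; exact: achievable_bounds.
by rewrite -clB.
Qed.
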